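(* For every integer $n \ge 19$ there exists a $4$-regular graph on $n$ vertices containing exactly $144$ hamiltonian cycles. Furthermore, for every integer $n' \ge 22$ there exists a planar $4$-regular graph on $n'$ vertices containing exactly $320$ hamiltonian cycles.
   Context: Graphs are finite, simple and connected. A hamiltonian cycle is a cycle through all vertices of the graph. *)

(* Defs.v *)
From mathcomp Require Import all_boot all_order all_algebra.
From mathcomp Require Import all_classical all_reals all_analysis.
Set Implicit Arguments.
Unset Strict Implicit.
Unset Printing Implicit Defensive.
Import numFieldNormedType.Exports.
Local Open Scope ring_scope.

Record graph := Graph {
  vertex :> finType;
  adj : rel vertex;
  adj_sym : symmetric adj;
  adj_irrefl : irreflexive adj }.

Definition connected_graph (G : graph) : Prop :=
  forall x y : G, connect (@adj G) x y.

Definition regular_graph (d : nat) (G : graph) : Prop :=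
  forall x : G, #|[set y : G | adj x y]%SET| = d.

Definition edges (G : graph) : {set {set G}} :=
  [set E : {set G} |
     [exists x : G, exists y : G, adj x y && (E == [set x; y])]]%SET.

Definition cycle_edges (G : graph) (s : seq G) : {set {set G}} :=
  [set [set x; next s x] | x in s]%SET.

(* A cycle is a subgraph, here identified with its edge set, so that the
   starting vertex and the direction of traversal are not counted. A
   duplicate-free sequence of length #|G| visits every vertex; the bound
   2 < #|G| excludes the closed walk of length 2 along a single edge. *)
Definition hamiltonian_cycles (G : graph) : {set {set {set G}}} :=
  [set C : {set {set G}} |
     (2 < #|G|)%N &&
     [exists s : #|G|.-tuple G,
        ucycleb (@adj G) s && (C == cycle_edges s)]]%SET.

Definition is_arc (R : realType) (p q : R * R) (A : set (R * R)) : Prop :=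
  exists f : R -> R * R,
    [/\ ({within `[0, 1], continuous f})%classic,
        {in `[0, 1] &, injective f},
        f 0 = p, f 1 = q & A = (f @` `[0, 1])%classic].

(* [curve E] is only meaningful when E is an edge of G. *)
Definition plane_drawing (R : realType) (G : graph)
    (pos : G -> R * R) (curve : {set G} -> set (R * R)) : Prop :=
  [/\ injective pos,
      forall x y : G, adj x y ->
        is_arc (pos x) (pos y) (curve [set x; y]%SET),
      forall (E : {set G}) (z : G),
        E \in edges G -> curve E (pos z) -> z \in E
    & forall (E F : {set G}) (p : R * R),
        E \in edges G -> F \in edges G -> E != F ->
        curve E p -> curve F p ->
        exists2 z : G, z \in (E :&: F)%SET & p = pos z].

Definition planar (R : realType) (G : graph) : Prop :=
  exists (pos : G -> R * R) (curve : {set G} -> set (R * R)),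
    plane_drawing pos curve.

(* Main.v *)
(** The vertices of the graph are two blocks [0, k) and [k, p), the vertex p and
    a right part (p, n).  Each block, K5 or the octahedron without an edge, is
    joined to the rest by exactly two edges, one of them ending in p, and a
    hamiltonian cycle uses both edges of a two-edge cut.  Hence it consists of a
    hamiltonian path in each block, p, and a hamiltonian path of the right part
    from n-2 to n-1.  The right part can be extended by a vertex n adjacent to
    n-1 and n-2, which then plays the role of n-1 while n-1 plays the role of
    n-2: a hamiltonian path from n-1 to n has to end with the edge {n-2, n}, so
    the number of such paths is unchanged.  This gives 6 * 6 * 4 = 144 and
    8 * 8 * 5 = 320 cycles for all n.

    For planarity the right part is drawn with straight edges in a triangle
    with n-2 and n-1 as corners; an affine map squeezes the drawing to make room
    for the next vertex, and the rest of the drawing does not change. *)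
Require Import Defs.
From mathcomp Require Import all_boot all_order all_algebra.
From mathcomp Require Import all_classical all_reals all_analysis.
From mathcomp Require Import zify ring lra.
Set Implicit Arguments.
Unset Strict Implicit.
Unset Printing Implicit Defensive.

(** * Hamiltonian paths *)

Lemma perm_cat_all (T : eqType) (s1 s2 V1 V2 : seq T) :
  perm_eq (s1 ++ s2) (V1 ++ V2) -> ~~ has (mem V1) V2 ->
  all (mem V1) s1 -> ~~ has (mem V1) s2 -> perm_eq s1 V1 /\ perm_eq s2 V2.
Proof.
have filter_out (s : seq T) :
    ~~ has (mem V1) s -> [seq z <- s | z \in V1] = [::].
  by rewrite has_filter negbK => /eqP.
move=> pV V12 s1V1 s2V1; have ps1 : perm_eq s1 V1.
  have V1V1 : all (mem V1) V1 by apply/allP.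
  have := perm_filter (mem V1) pV.
  rewrite !filter_cat (filter_out s2) // (filter_out V2) // !cats0.
  by rewrite (all_filterP s1V1) (all_filterP V1V1).
by split=> //; rewrite -(perm_cat2l V1) -(permPr pV) perm_cat2r perm_sym.
Qed.

Lemma path_first_exit (T : eqType) (E : rel T) (X : pred T) x t :
  path E x t -> ~~ all X t ->
  exists t1 z t2, [/\ t = t1 ++ z :: t2, all X t1, ~~ X z, E (last x t1) z
                     & path E z t2].
Proof.
rewrite -has_predC => + hasC; case/split_find: hasC => z t1 t2 nXz.
rewrite has_predC negbK cat_rcons cat_path /= => Xt1 /and3P[_ Ez Et2].
by exists t1, z, t2.
Qed.

Lemma not_all_behead (T : eqType) (X : pred T) x t w :
  X x -> w \in x :: t -> ~~ X w -> ~~ all X t.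
Proof.
move=> Xx; rewrite inE => /predU1P[->|wt nXw]; first by rewrite Xx.
by apply/allPn; exists w.
Qed.

Section Cuts.
Variables (T : eqType) (E : rel T) (X : pred T) (a b x u : T).
Implicit Types (t : seq T).
Hypotheses (Esym : symmetric E) (Xx : X x).

Definition cut_edges t :=
  {in t &, forall y z, X y -> ~~ X z -> E y z ->
     (y, z) = (a, b) \/ (y, z) = (x, u)}.

(* Having left [X] by [ab], the path can return only through [a] or [x], both
   already visited. *)
Lemma path_cut t :
  cut_edges (x :: t) -> uniq (x :: t) -> path E x t -> ~~ all X t ->
  head x t = u \/
  exists t1 t2, [/\ t = t1 ++ b :: t2, all X t1, last x t1 = a
                  & ~~ has X (b :: t2)].
Proof.
move=> + + Et nXt.
have [t1 [z [t2 [-> Xt1 nXz Elz Et2]]]] := path_first_exit Et nXt.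
rewrite /cut_edges -cat_cons => cutE ut.
have mem1 y : y \in x :: t1 -> y \in (x :: t1) ++ z :: t2.
  by rewrite mem_cat => ->.
have mem2 y : y \in z :: t2 -> y \in (x :: t1) ++ z :: t2.
  by rewrite mem_cat orbC => ->.
have Xl : X (last x t1).
  by apply: (allP (_ : all X (x :: t1))); rewrite /= ?Xx ?mem_last.
have last1 := mem1 _ (mem_last x t1); have head2 := mem2 _ (mem_head z t2).
have [[lx zb]|[lx zu]] := cutE _ _ last1 head2 Xl nXz Elz.
  right; exists t1, t2; rewrite -zb; split=> //=.
  rewrite negb_or nXz -all_predC.
  apply: contraT => /(path_first_exit Et2)[t3 [w [t4 [t2E nXt3 + Ew _]]]].
  rewrite negbK => Xw; have nXl : ~~ X (last z t3).
    by apply: (allP (_ : all (predC X) (z :: t3))); rewrite /= ?nXz ?mem_last.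
  have wt2 : w \in z :: t2 by rewrite t2E inE mem_cat mem_head !orbT.
  have lt2 : last z t3 \in z :: t2 by rewrite t2E -cat_cons mem_cat mem_last.
  have wt1 : w \notin x :: t1.
    by move: ut; rewrite cat_uniq => /and3P[_ /hasPn disj _]; apply: disj.
  rewrite Esym in Ew.
  have [[wa _]|[wx _]] := cutE _ _ (mem2 _ wt2) (mem2 _ lt2) Xw nXl Ew.
    by move: wt1; rewrite wa -lx mem_last.
  by move: wt1; rewrite wx mem_head.
left; case: t1 lx ut {mem1 mem2 last1 head2 Xt1 Xl Elz cutE} => //= y t1 lx.
by rewrite -cat_cons mem_cat -{1}lx mem_last.
Qed.

Lemma cycle_cut t :
  cut_edges (x :: t) -> x != a -> uniq (x :: t) -> cycle E (x :: t) ->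
  ~~ all X t -> head x t = u \/ last x t = u.
Proof.
move=> cutE xa ut; rewrite /= rcons_path => /andP[Et El] nXt.
have [->|[t1 [t2 [tE _ _ /hasPn nXt2]]]] := path_cut cutE ut Et nXt.
  by left.
right; have nXl : ~~ X (last x t) by rewrite nXt2 // tE last_cat /= mem_last.
rewrite Esym in El.
have := cutE x _ (mem_head _ _) (mem_last _ _) Xx nXl El.
by case=> -[// xa' _]; rewrite xa' eqxx in xa.
Qed.
End Cuts.

Section HamiltonianPaths.
Variable T : eqType.
Implicit Types (E : rel T) (V s t : seq T) (x y : T).

Definition ham_path E V x y s :=
  if s is z :: t then [&& z == x, perm_eq s V, path E x t & last x t == y]
  else false.

Lemma ham_pathP E V x y s :
  reflect (exists t, [/\ s = x :: t, perm_eq s V, path E x t & last x t = y])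
          (ham_path E V x y s).
Proof.
case: s => [|z t] /=; first by right=> -[? []].
apply: (iffP and4P) => [[/eqP-> pV Et /eqP lt]|[_ [[-> <-] pV Et /eqP lt]]] //.
by exists t.
Qed.

Lemma ham_path_perm E V x y s : ham_path E V x y s -> perm_eq s V.
Proof. by case/ham_pathP => t []. Qed.

Definition ham_paths E V x y := [seq s <- permutations V | ham_path E V x y s].

Definition num_ham_paths E V x y := size (ham_paths E V x y).

Lemma mem_ham_paths E V x y s : (s \in ham_paths E V x y) = ham_path E V x y s.
Proof.
by rewrite mem_filter mem_permutations andb_idr // => /ham_path_perm.
Qed.

Lemma ham_paths_uniq E V x y : uniq (ham_paths E V x y).
Proof. by rewrite filter_uniq ?permutations_uniq. Qed.

Lemma num_ham_paths_enum E V x y (S : seq (seq T)) :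
  uniq S -> (forall s, (s \in S) = ham_path E V x y s) ->
  num_ham_paths E V x y = size S.
Proof.
move=> uS memS; apply/perm_size/uniq_perm => //; first exact: ham_paths_uniq.
by move=> s; rewrite mem_ham_paths memS.
Qed.

Lemma perm_num_ham_paths E V V' x y :
  perm_eq V V' -> num_ham_paths E V x y = num_ham_paths E V' x y.
Proof.
move=> pV; apply: num_ham_paths_enum (ham_paths_uniq _ _ _ _) _ => s.
by rewrite mem_ham_paths; case: s => //= z t; rewrite (permPr pV).
Qed.

Lemma num_ham_paths0 E V x y :
  (forall s, ~~ ham_path E V x y s) -> num_ham_paths E V x y = 0.
Proof.
move=> no_path; apply: (@num_ham_paths_enum _ _ _ _ [::]) => // s.
exact/esym/negbTE.
Qed.

Lemma num_ham_paths1 E x : num_ham_paths E [:: x] x x = 1.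
Proof.
apply: (@num_ham_paths_enum _ _ _ _ [:: [:: x]]) => // s; rewrite inE.
apply/eqP/ham_pathP => [->|[[|z t] [-> /perm_size]]] //.
by exists [::]; rewrite perm_refl.
Qed.

Lemma num_ham_paths_rev E V x y :
  symmetric E -> num_ham_paths E V x y = num_ham_paths E V y x.
Proof.
move=> Esym; rewrite -[RHS](size_map rev); apply: num_ham_paths_enum.
  by rewrite map_inj_uniq ?ham_paths_uniq //; apply: (can_inj revK).
have ham_rev z w s : ham_path E V z w s -> ham_path E V w z (rev s).
  case/ham_pathP => t [-> pV Et lt].
  have rt : rev (z :: t) = w :: rev (belast z t) by rewrite lastI rev_rcons lt.
  apply/ham_pathP; exists (rev (belast z t)).
  rewrite -{1}rt perm_rev; split=> //.
    by rewrite -lt rev_path -(eq_path (e := E)).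
  by rewrite -[LHS]/(last w (w :: rev (belast z t))) -rt rev_cons last_rcons.
move=> s; rewrite -{1}[s]revK mem_map; last exact: (can_inj revK).
by rewrite mem_ham_paths; apply/idP/idP => /ham_rev; rewrite ?revK.
Qed.

Lemma num_ham_paths_cons E V x y :
  uniq V -> 0 < size V ->
  num_ham_paths E (x :: V) x y = \sum_(z <- V | E x z) num_ham_paths E V z y.
Proof.
move=> uV V0; pose nbrs := [seq z <- V | E x z].
transitivity (size [seq x :: s | z <- nbrs, s <- ham_paths E V z y]);
  last by rewrite size_allpairs_dep sumnE big_map big_filter.
apply: num_ham_paths_enum => [|s].
  apply: allpairs_uniq_dep; first exact: filter_uniq.
    by move=> z _; exact: ham_paths_uniq.
  move=> _ _ /allpairsPdep[z [s [_ sP ->]]]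
    /allpairsPdep[w [t [_ tP ->]]] /= [].
  move: sP tP; rewrite !mem_ham_paths.
  by move=> /ham_pathP[s' [-> _ _ _]] /ham_pathP[t' [-> _ _ _]] [-> ->].
apply/allpairsPdep/ham_pathP => [[z [s' [+ + ->]]]|[[|z t] [-> pV]]].
- rewrite mem_filter mem_ham_paths => /andP[xz _] /ham_pathP[t [-> pt Et lt]].
  by exists (z :: t); split; rewrite //= ?perm_cons ?xz.
- by move: V0; rewrite -[size V]/(size (x :: V)).-1 -(perm_size pV).
rewrite perm_cons in pV; move=> /= /andP[xz Et] lt; exists z, (z :: t).
rewrite mem_filter xz -(perm_mem pV) mem_head mem_ham_paths; split=> //.
by apply/ham_pathP; exists t.
Qed.

Fixpoint count_ham_paths E n V x y : nat :=
  if n is m.+1 then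
    sumn [seq count_ham_paths E m (rem z V) z y | z <- V & E x z]
  else x == y.

Lemma num_ham_pathsE E V x y :
  uniq V -> x \in V ->
  num_ham_paths E V x y = count_ham_paths E (size V).-1 (rem x V) x y.
Proof.
move sV: (size V) => n; elim: n V x sV => [|n IHn] V x sV uV xV.
  by rewrite (size0nil sV) in xV.
rewrite (perm_num_ham_paths _ _ _ (perm_to_rem xV)).
have [ur sr] : uniq (rem x V) /\ size (rem x V) = n.
  by rewrite rem_uniq ?size_rem ?sV.
case: n IHn sr {sV} => [|n] IHn sr.
  rewrite (size0nil sr) /=; case: (eqVneq x y) => [<-|xy].
    exact: num_ham_paths1.
  apply: num_ham_paths0 => s; apply/ham_pathP.
  by case=> -[|z t] [-> pV _ lt]; [case/eqP: xy | have := perm_size pV].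
rewrite num_ham_paths_cons ?sr //= sumnE big_map big_filter big_seq_cond.
by rewrite [RHS]big_seq_cond; apply: eq_bigr => z /andP[zr _]; rewrite IHn ?sr.
Qed.

Lemma ham_path_cat E V1 V2 x y a b s1 s2 :
  ham_path E V1 x a s1 -> E a b -> ham_path E V2 b y s2 ->
  ham_path E (V1 ++ V2) x y (s1 ++ s2).
Proof.
move=> /ham_pathP[t1 [-> pV1 Et1 l1]] Eab /ham_pathP[t2 [-> pV2 Et2 l2]].
apply/ham_pathP; exists (t1 ++ b :: t2); split=> //; first exact: perm_cat.
  by rewrite cat_path /= Et1 l1 Eab.
by rewrite last_cat.
Qed.

End HamiltonianPaths.

Section HamiltonianPathsCut.
Variables (T : eqType) (E : rel T) (V1 V2 : seq T).
Implicit Types (s t : seq T) (x y a b : T).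
Hypotheses (Esym : symmetric E) (uV : uniq (V1 ++ V2)).

Let V12 : ~~ has (mem V1) V2.
Proof. by move: uV; rewrite cat_uniq => /and3P[]. Qed.

Let notin_V1 y : y \in V2 -> y \notin V1.
Proof. by move/hasPn: V12; apply. Qed.

Lemma cut_edges_cat t a b x u :
  perm_eq t (V1 ++ V2) ->
  {in V1 & V2, forall y z, E y z -> (y, z) = (a, b) \/ (y, z) = (x, u)} ->
  cut_edges E (mem V1) a b x u t.
Proof.
move=> pV cutE y z _ zt yV1 zV1; apply: cutE => //.
by move: zt; rewrite (perm_mem pV) mem_cat => /orP[zV1'|//]; case/negP: zV1.
Qed.

Lemma not_all_V1 x y t :
  perm_eq (x :: t) (V1 ++ V2) -> x \in V1 -> y \in V2 -> ~~ all (mem V1) t.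
Proof.
move=> pV xV1 yV2; apply: (@not_all_behead _ _ x _ y) => //.
  by rewrite (perm_mem pV) mem_cat yV2 orbT.
exact: notin_V1.
Qed.

Lemma ham_path_split x y a b s :
  x \in V1 -> a \in V1 -> b \in V2 -> y \in V2 ->
  {in V1 & V2, forall z w, E z w -> (z, w) = (a, b) \/ (z, w) = (x, y)} ->
  ham_path E (V1 ++ V2) x y s ->
  exists s1 s2, [/\ s = s1 ++ s2, ham_path E V1 x a s1 & ham_path E V2 b y s2].
Proof.
move=> xV1 aV1 bV2 yV2 cutE /ham_pathP[t [-> pV Et lt]].
have ut : uniq (x :: t) by rewrite (perm_uniq pV).
suff [t1 [t2 [tE V1t1 la V1t2]]] : exists t1 t2,
    [/\ t = t1 ++ b :: t2, all (mem V1) t1, last x t1 = a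
      & ~~ has (mem V1) (b :: t2)].
  move: pV Et lt; rewrite tE cat_path last_cat /= => pV /and3P[Et1 _ Et2] lt.
  have xt1V1 : all (mem V1) (x :: t1) by apply/andP.
  have [pV1 pV2] := perm_cat_all (s1 := x :: t1) pV V12 xt1V1 V1t2.
  exists (x :: t1), (b :: t2); split=> //; apply/ham_pathP; first by exists t1.
  by exists t2.
have nV1t := not_all_V1 pV xV1 yV2.
have [hy|//] := path_cut Esym xV1 (cut_edges_cat pV cutE) ut Et nV1t.
(* The path consists of the edge [xy], whence [x = a] and [y = b]. *)
have tE : t = [:: y].
  case: t hy lt ut {pV Et nV1t} => [xy|_ [|z t] /= -> //].
    by case/negP: (notin_V1 yV2); rewrite -xy.
  by move=> <- /and3P[_]; rewrite mem_last.
rewrite tE in pV *; have nyV1 := notin_V1 yV2.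
have [||/perm_mem V1x /perm_mem V2y] := perm_cat_all (s1 := [:: x]) pV V12.
- by rewrite /= andbT.
- by rewrite /= orbF.
move: aV1 bV2; rewrite -V1x -V2y !inE => /eqP-> /eqP->.
by exists [::], [::]; rewrite /= orbF.
Qed.

Theorem num_ham_paths_cut x y a b :
  x \in V1 -> a \in V1 -> b \in V2 -> y \in V2 -> E a b ->
  {in V1 & V2, forall z w, E z w -> (z, w) = (a, b) \/ (z, w) = (x, y)} ->
  num_ham_paths E (V1 ++ V2) x y =
  num_ham_paths E V1 x a * num_ham_paths E V2 b y.
Proof.
move=> xV1 aV1 bV2 yV2 Eab cutE; rewrite -(size_allpairs cat).
apply: num_ham_paths_enum => [|s].
  apply: allpairs_uniq; rewrite ?ham_paths_uniq // => -[s1 s2] [t1 t2].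
  move=> /allpairsP[[? ?] [+ _ [-> ->]]] /allpairsP[[? ?] [+ _ [-> ->]]].
  rewrite !mem_ham_paths.
  move=> /ham_path_perm/perm_size ss /ham_path_perm/perm_size st.
  by move=> /eqP; rewrite eqseq_cat ?ss ?st // => /andP[/eqP-> /eqP->].
apply/allpairsP/idP => [[[s1 s2]]|].
  by rewrite !mem_ham_paths => -[s1P s2P ->]; exact: ham_path_cat s1P Eab s2P.
move=> /(ham_path_split xV1 aV1 bV2 yV2 cutE)[s1 [s2 [-> s1P s2P]]].
by exists (s1, s2); rewrite !mem_ham_paths.
Qed.

Lemma num_ham_paths_bridge0 x y a b w :
  x \in V1 -> y \in V1 -> w \in V2 ->
  {in V1 & V2, forall z v, E z v -> (z, v) = (a, b)} ->
  num_ham_paths E (V1 ++ V2) x y = 0.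
Proof.
move=> xV1 yV1 wV2 bridge; apply: num_ham_paths0 => s; apply/ham_pathP.
case=> t [-> pV Et lt]; have ut : uniq (x :: t) by rewrite (perm_uniq pV).
have nV1t := not_all_V1 pV xV1 wV2.
have cutE : cut_edges E (mem V1) a b x x (x :: t).
  by apply: cut_edges_cat pV _ => z v zV1 vV2 /(bridge z v zV1 vV2); left.
have [hx|[t1 [t2 [tE _ _ /hasPn nV1t2]]]] := path_cut Esym xV1 cutE ut Et nV1t.
  by case: t {Et lt pV cutE} hx ut nV1t => //= z t ->; rewrite mem_head.
have lb : last b t2 = y by rewrite -lt tE last_cat.
by case/negP: (nV1t2 _ (mem_last b t2)); rewrite lb.
Qed.
End HamiltonianPathsCut.

Lemma num_ham_paths_map (T T' : eqType) (f : T -> T') (E : rel T) (E' : rel T')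
    (V : seq T) (x y : T) :
  injective f -> {in V &, forall z w, E' (f z) (f w) = E z w} ->
  num_ham_paths E' (map f V) (f x) (f y) = num_ham_paths E V x y.
Proof.
move=> f_inj fE; rewrite -[RHS](size_map (map f)).
apply: num_ham_paths_enum => [|s].
  by rewrite map_inj_uniq ?ham_paths_uniq //; apply: inj_map.
have ham_map t :
    ham_path E' (map f V) (f x) (f y) (map f t) = ham_path E V x y t.
  case: t => //= z t; rewrite inj_eq // last_map inj_eq // path_map.
  rewrite -map_cons; case: (eqVneq z x) => //= ->.
  have -> : perm_eq (map f (x :: t)) (map f V) = perm_eq (x :: t) V.
    by apply/idP/idP => [/(perm_map_inj f_inj)|/(perm_map f)].
  case: (boolP (perm_eq _ _)) => //= pV; congr andb.
  apply: (@eq_in_path _ (mem V)) => //.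
  by apply/allP => w; rewrite (perm_mem pV).
apply/mapP/idP => [[t + ->]|hs]; first by rewrite mem_ham_paths ham_map.
have /(perm_iotaP (f x))[Is pIs sE] := ham_path_perm hs.
have sE' : s = map f (map (nth x V) Is).
  rewrite sE -map_comp; apply/eq_in_map => i.
  by rewrite (perm_mem pIs) mem_iota size_map => iV; rewrite (nth_map x).
by exists (map (nth x V) Is); rewrite // mem_ham_paths -ham_map -sE'.
Qed.

Lemma eq_in_num_ham_paths (T : eqType) (E E' : rel T) (V : seq T) (x y : T) :
  {in V &, E =2 E'} -> num_ham_paths E V x y = num_ham_paths E' V x y.
Proof. by move=> eE; rewrite -(@num_ham_paths_map _ _ id E' E) ?map_id. Qed.

(** * Hamiltonian cycles as edge sets *)

Lemma set2_eq (T : finType) (x y z w : T) :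
  [set x; y]%SET = [set z; w]%SET -> (x = z /\ y = w) \/ (x = w /\ y = z).
Proof.
move=> e; have := finset.set21 x y; have := finset.set22 x y.
have := finset.set21 z w; have := finset.set22 z w.
rewrite {1 2}e -{1 2}e !inE.
by do 4![case/orP=> /eqP ?]; subst; auto.
Qed.

Lemma uniq_perm_enum (T : finType) (s : seq T) :
  uniq s -> size s = #|T| -> perm_eq s (enum T).
Proof.
move=> us sT; apply: uniq_perm; rewrite ?enum_uniq //.
have sub : {subset s <= enum T} by move=> x _; rewrite mem_enum.
by have [|_] := uniq_min_size us sub; rewrite -?cardE ?sT.
Qed.

Lemma next_last (T : eqType) (x : T) t :
  uniq (x :: t) -> next (x :: t) (last x t) = x.
Proof.
move=> ut; rewrite next_nth mem_last (last_nth x) index_uniq //= ?ltnS //.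
by rewrite nth_default.
Qed.

Lemma prev_head (T : eqType) (x : T) t :
  uniq (x :: t) -> prev (x :: t) x = last x t.
Proof. by move=> ut; rewrite -{2}(next_last ut) prev_next. Qed.

Lemma next_neq_prev (T : eqType) (s : seq T) x :
  uniq s -> 2 < size s -> x \in s -> next s x != prev s x.
Proof.
move=> us s2 /rot_to[i t sE]; rewrite -(next_rot i us) -(prev_rot i us) sE.
have ut : uniq (x :: t) by rewrite -sE rot_uniq.
case: t sE ut => [|y [|z t]] sE ut; try by rewrite -(size_rot i) sE in s2.
move: (ut); rewrite /= !inE !negb_or => /andP[/and3P[xy xz _] _].
apply/eqP => /(congr1 (next [:: x, y, z & t])); rewrite next_prev //= eqxx.
by rewrite eq_sym (negbTE xy) eqxx => zx; rewrite zx eqxx in xz.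
Qed.

Section CycleEdges.
Variable G : graph.
Implicit Types (x u : G) (s t : seq G).

Lemma cycle_edges_rot i s : uniq s -> cycle_edges (rot i s) = cycle_edges s.
Proof.
move=> us; apply/setP => e.
apply/imsetP/imsetP => -[x xs ->]; exists x;
  by rewrite ?next_rot // ?mem_rot in xs *.
Qed.

Lemma cycle_edges_rev s : uniq s -> cycle_edges (rev s) = cycle_edges s.
Proof.
move=> us; apply/setP => e; apply/imsetP/imsetP => -[x xs ->].
  exists (prev s x); first by rewrite mem_prev -mem_rev.
  by rewrite next_rev // next_prev // finset.setUC.
exists (next s x); first by rewrite mem_rev mem_next.
by rewrite next_rev // prev_next // finset.setUC.
Qed.

Lemma next_cycle_edges s t x :
  uniq t -> cycle_edges s = cycle_edges t -> x \in s ->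
  next s x = next t x \/ next s x = prev t x.
Proof.
move=> ut est xs.
have : [set x; next s x]%SET \in cycle_edges s by apply: imset_f.
rewrite est => /imsetP[y yt] /set2_eq[[<- ->]|[xy ->]]; first by left.
by right; rewrite xy prev_next.
Qed.

(* The common predecessor of [x] fixes the direction in which the cycle is
   traversed. *)
Lemma iter_next_cycle_edges s t x i :
  uniq s -> uniq t -> 2 < size s -> x \in s -> cycle_edges s = cycle_edges t ->
  prev s x = prev t x -> iter i (next s) x = iter i (next t) x.
Proof.
move=> us ut s2 xs est pst; suff: iter i (next s) x = iter i (next t) x /\
  prev s (iter i (next s) x) = prev t (iter i (next s) x) by case.
elim: i => [|i [IHi IHp]] //; rewrite !iterS -IHi.
set z := iter i (next s) x in IHp *.
have zs : z \in s by rewrite /z; elim: (i) => //= j; rewrite mem_next.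
have nextE : next s z = next t z.
  have := next_neq_prev us s2 zs.
  by have [//|->] := next_cycle_edges ut est zs; rewrite IHp eqxx.
by split; rewrite // prev_next // nextE prev_next.
Qed.

Lemma cycle_edges_inj x s t :
  uniq (x :: s) -> uniq (x :: t) -> size s = size t -> 1 < size s ->
  last x s = last x t -> cycle_edges (x :: s) = cycle_edges (x :: t) -> s = t.
Proof.
move=> us ut st s1 lst est.
have trajE r : uniq (x :: r) -> x :: r = traject (next (x :: r)) x (size r).+1.
  move=> /cycle_next; rewrite [fcycle _ _]rcons_path.
  by case/andP => /fpathE/(congr1 (cons x)).
suff: x :: s = x :: t by case.
rewrite [LHS](trajE s us) [RHS](trajE t ut) st.
apply: (@eq_from_nth _ x) => [|i].
  by rewrite !size_traject.
rewrite size_traject => it; rewrite !nth_traject //.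
by apply: iter_next_cycle_edges; rewrite ?mem_head ?prev_head.
Qed.

Lemma hamiltonian_cyclesP x C : 2 < #|G| ->
  reflect (exists t, [/\ ucycle (@adj G) (x :: t), perm_eq (x :: t) (enum G)
                       & C = cycle_edges (x :: t)])
          (C \in hamiltonian_cycles G).
Proof.
move=> G2; rewrite inE G2.
apply: (iffP existsP) => [[s /andP[/andP[cs us] /eqP->]]|].
  have ps := uniq_perm_enum us (size_tuple s).
  have /rot_to[i t sE] : x \in (s : seq G) by rewrite (perm_mem ps) mem_enum.
  exists t; rewrite /ucycle -sE rot_cycle cs rot_uniq us cycle_edges_rot //.
  by rewrite perm_rot.
move=> [t [/andP[ct ut] pt ->]].
have st : size (x :: t) == #|G| by rewrite cardE (perm_size pt).
by exists (Tuple st); rewrite /ucycleb ct ut eqxx.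
Qed.

Lemma ucycle_reverse x t : ucycle (@adj G) (x :: t) ->
  ucycle (@adj G) (x :: rev t) /\
  cycle_edges (x :: rev t) = cycle_edges (x :: t).
Proof.
case/andP => ct ut; have <- : rot (size t) (rev (x :: t)) = x :: rev t.
  by rewrite rev_cons -cats1 -(size_rev t) rot_size_cat.
rewrite cycle_edges_rot ?cycle_edges_rev ?rev_uniq // /ucycle.
rewrite rot_cycle rev_cycle rot_uniq rev_uniq ut andbT.
by rewrite -(eq_cycle (e := @adj G)) //; exact: adj_sym.
Qed.

Section CommonEdge.
Variables x u : G.
Hypotheses (G2 : 2 < #|G|) (xu : adj x u).
Hypothesis common_edge : forall t,
  ucycle (@adj G) (x :: t) -> perm_eq (x :: t) (enum G) ->
  head x t = u \/ last x t = u.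

Lemma hamiltonian_cycle_ham_path C :
  (C \in hamiltonian_cycles G) =
  (C \in map (@cycle_edges G) (ham_paths (@adj G) (enum G) x u)).
Proof.
apply/(hamiltonian_cyclesP x C G2)/mapP => [[t [ct pt ->]]|[s + ->]].
  have ham_pathI r : ucycle (@adj G) (x :: r) -> perm_eq (x :: r) (enum G) ->
      last x r = u -> x :: r \in ham_paths (@adj G) (enum G) x u.
    rewrite mem_ham_paths => /andP[cr _] pr lr; apply/ham_pathP; exists r.
    by move: cr; rewrite /= rcons_path => /andP[].
  have [hu|lu] := common_edge ct pt;
    last by exists (x :: t); rewrite ?ham_pathI.
  have [crt <-] := ucycle_reverse ct.
  exists (x :: rev t) => //; apply: ham_pathI => //.
    by rewrite -(permPr pt) perm_cons perm_rev.
  by case: (t) hu => [|z r] //= ->; rewrite rev_cons last_rcons.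
rewrite mem_ham_paths => /ham_pathP[t [-> pt Et lt]]; exists t; split=> //.
by rewrite /ucycle (perm_uniq pt) enum_uniq andbT /= rcons_path Et lt adj_sym.
Qed.

Lemma card_hamiltonian_cycles :
  #|hamiltonian_cycles G| = num_ham_paths (@adj G) (enum G) x u.
Proof.
rewrite /num_ham_paths -(size_map (@cycle_edges G)) cardE.
apply/perm_size/uniq_perm; first exact: enum_uniq; last first.
  by move=> C; rewrite mem_enum hamiltonian_cycle_ham_path.
have perm_enumE s : perm_eq s (enum G) -> uniq s /\ size s = #|G|.
  by move=> ps; rewrite (perm_uniq ps) enum_uniq (perm_size ps) -cardE.
rewrite map_inj_in_uniq ?ham_paths_uniq // => s t; rewrite !mem_ham_paths.
move=> /ham_pathP[s' [-> /perm_enumE[us ss] _ ls]].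
move=> /ham_pathP[t' [-> /perm_enumE[ut st] _ lt]] est.
congr cons; apply: cycle_edges_inj est => //; last by rewrite ls lt.
  exact: succn_inj (etrans ss (esym st)).
by rewrite -ltnS -[X in _ < X]/(size (x :: s')) ss.
Qed.
End CommonEdge.

Lemma hamiltonian_connected : 0 < #|hamiltonian_cycles G| -> connected_graph G.
Proof.
case/card_gt0P => C; rewrite inE.
case/andP => G2 /existsP[s /andP[/andP[cs us] _]] x y.
have mem_s z : z \in (s : seq G).
  by rewrite (perm_mem (uniq_perm_enum us (size_tuple s))) mem_enum.
exact: connect_cycle cs _ _ (mem_s x) (mem_s y).
Qed.
End CycleEdges.

Section OrdinalGraph.
Variables (n : nat) (E : rel nat).
Hypotheses (Esym : symmetric E) (Eirr : irreflexive E).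

Definition ord_graph : graph :=
  @Graph 'I_n (relpre val E)
    (fun x y => Esym (val x) (val y)) (fun x => Eirr (val x)).

Lemma ord_graph_regular d :
  (forall x, x < n -> count (E x) (iota 0 n) = d) -> regular_graph d ord_graph.
Proof.
move=> degE x; rewrite cardsE cardE /enum_mem size_filter -enumT.
by rewrite -(degE x (ltn_ord x)) -val_enum_ord count_map; apply: eq_count.
Qed.

Lemma card_ord_graph_cycles (X : pred nat) x u a b :
  2 < n -> x < n -> u < n -> X x -> ~~ X u -> x != a -> E x u ->
  (forall y z, y < n -> z < n -> X y -> ~~ X z -> E y z ->
     (y, z) = (a, b) \/ (y, z) = (x, u)) ->
  #|hamiltonian_cycles ord_graph| = num_ham_paths E (iota 0 n) x u.
Proof.
move=> n2 xn un Xx nXu xa Exu cutE.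
pose xo : ord_graph := Ordinal xn; pose uo : ord_graph := Ordinal un.
rewrite (@card_hamiltonian_cycles ord_graph xo uo) ?card_ord //.
  rewrite -val_enum_ord -[x]/(val xo) -[u]/(val uo).
  by apply/esym/num_ham_paths_map => //; exact: val_inj.
move=> t /andP[ct ut] pt.
have lt_n y : y \in map val (xo :: t) -> y < n.
  by case/mapP => z _ ->; exact: ltn_ord.
suff [hu|lu] : head x (map val t) = u \/ last x (map val t) = u.
- by left; apply: val_inj; case: (t) hu.
- by right; apply: val_inj; rewrite -[LHS](last_map val).
apply: (@cycle_cut _ E X a b) => //.
- by move=> y z /lt_n yn /lt_n zn; exact: cutE.
- by rewrite -[x :: _]/(map val (xo :: t)) map_inj_uniq //; exact: val_inj.
- by rewrite -[x :: _]/(map val (xo :: t)) cycle_map.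
apply: (@not_all_behead _ X x _ u) => //.
rewrite -[x :: _]/(map val (xo :: t)) (map_f val (_ : uo \in _)) //.
by rewrite (perm_mem pt) mem_enum.
Qed.
End OrdinalGraph.

(** * Graphs given by lists of edges *)

Definition edge_rel (es : seq (nat * nat)) : rel nat :=
  fun x y => (x != y) && (((x, y) \in es) || ((y, x) \in es)).

Lemma edge_rel_sym es : symmetric (edge_rel es).
Proof. by move=> x y; rewrite /edge_rel eq_sym orbC. Qed.

Lemma edge_rel_irrefl es : irreflexive (edge_rel es).
Proof. by move=> x; rewrite /edge_rel eqxx. Qed.

Definition edge_list n (es : seq (nat * nat)) :=
  uniq es && all (fun e => e.1 < e.2 < n) es.

Definition degree (es : seq (nat * nat)) x :=
  count (fun e => (e.1 == x) || (e.2 == x)) es.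

Lemma edge_listP n es e : edge_list n es -> e \in es -> e.1 < e.2 < n.
Proof. by case/andP=> _ /allP; apply. Qed.

Lemma edge_rel_lt n es x y :
  edge_list n es -> x < y -> edge_rel es x y = ((x, y) \in es).
Proof.
move=> esP xy; rewrite /edge_rel ltn_eqF //=.
by apply: orb_idr => /(edge_listP esP) /=; lia.
Qed.

Lemma degree_ge n es x : edge_list n es -> n <= x -> degree es x = 0.
Proof.
move=> esP nx; apply/eqP; rewrite -leqn0 leqNgt -has_count -all_predC.
by apply/allP => e /(edge_listP esP) /=; lia.
Qed.

Lemma count_edge_rel n es x :
  edge_list n es -> count (edge_rel es x) (iota 0 n) = degree es x.
Proof.
move=> esP; have ltP := edge_listP esP; have [ues _] := andP esP.
pose other (e : nat * nat) := if e.1 == x then e.2 else e.1.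
rewrite /degree -!size_filter -[RHS](size_map other).
apply/perm_size/uniq_perm; first by rewrite filter_uniq ?iota_uniq.
  rewrite map_inj_in_uniq ?filter_uniq // => -[a b] [c d].
  rewrite !mem_filter /other /= => /andP[abx /ltP/= ab] /andP[cdx /ltP/= cd] ef.
  congr pair; move: abx cdx ef;
    by case: (eqVneq a x); case: (eqVneq c x); lia.
move=> y; rewrite mem_filter mem_iota /edge_rel; apply/idP/mapP => [|[[a b]]].
  case/andP=> /andP[xy /orP[xyE|yxE]] _.
    by exists (x, y); rewrite ?mem_filter ?xyE /other /= eqxx.
  exists (y, x); rewrite ?mem_filter ?yxE /other /= ?eqxx ?orbT //.
  by rewrite eq_sym (negbTE xy).
rewrite mem_filter /other /= => /andP[abx abE] ->; have := ltP _ abE => /= ab.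
by case: (eqVneq a x) abx abE ab => [-> _|_ /= /eqP->] -> ab;
  rewrite ?orbT; lia.
Qed.

Definition edge_graph n es : graph :=
  ord_graph n (@edge_rel_sym es) (@edge_rel_irrefl es).

Lemma edge_graph_regular n es d :
  edge_list n es -> all (fun x => degree es x == d) (iota 0 n) ->
  regular_graph d (edge_graph n es).
Proof.
move=> esP /allP degE; apply: ord_graph_regular => x xn.
by rewrite (count_edge_rel _ esP); apply/eqP/degE; rewrite mem_iota.
Qed.

(** * The construction *)

Section Construction.
Variables k p : nat.
Implicit Types (es : seq (nat * nat)) (n : nat).

Definition add_vertex n es := [:: (n.-2, n), (n.-1, n) & es].

Definition closed_edges n es :=
  [:: (k.-1, n.-1), (p, n.-1), (p.-1, n.-2) & es].

Record extendable n es : Prop := Extendable {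
  extendable_sizes : [&& 1 < k, k < p & p.+3 < n];
  center_edges : ((0, p) \in es) && ((k, p) \in es);
  X_boundary : all (fun e => (e.1 < k <= e.2) ==> (e == (0, p))) es;
  Y_boundary : all (fun e => (k <= e.1 < p) && (p <= e.2) ==> (e == (k, p))) es;
  closed_edge_list : edge_list n (closed_edges n es);
  degree_closed : all (fun x => degree (closed_edges n es) x == 4) (iota 0 n) }.

Definition num_block_paths n es :=
  num_ham_paths (edge_rel es) (iota 0 k) k.-1 0 *
  (num_ham_paths (edge_rel es) (iota k (p - k)) k p.-1 *
   num_ham_paths (edge_rel es) (iota p.+1 (n - p.+1)) n.-2 n.-1).

Lemma extendable_edge_list n es : extendable n es -> edge_list n es.
Proof.
move/closed_edge_list; rewrite /edge_list /=.
by move=> /andP[/and4P[_ _ _ ->] /and4P[_ _ _ ->]].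
Qed.

Section Extendable.
Variables (n : nat) (es : seq (nat * nat)).
Hypothesis esE : extendable n es.

Local Notation E := (edge_rel (closed_edges n es)).
Local Notation X := (iota 0 k).
Local Notation Y := (iota k (p - k)).
Local Notation Z := (iota p.+1 (n - p.+1)).

Let sizes : [/\ 1 < k, k < p & p.+3 < n].
Proof. exact/and3P/(extendable_sizes esE). Qed.

Let E_lt x y : x < y -> E x y = ((x, y) \in closed_edges n es).
Proof. exact: edge_rel_lt (closed_edge_list esE). Qed.

Let uniq_YZ : uniq (Y ++ Z).
Proof.
have [k1 kp pn] := sizes; rewrite cat_uniq !iota_uniq andbT /=.
by apply/hasPn => x; rewrite !mem_iota /=; lia.
Qed.

Lemma extendable_edge e : e \in es ->
  [/\ e.1 < e.2 < n, e.1 < k <= e.2 -> e = (0, p)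
    & (k <= e.1 < p) && (p <= e.2) -> e = (k, p)].
Proof.
move=> ees; split; first exact: edge_listP (extendable_edge_list esE) ees.
  by move/(implyP (allP (X_boundary esE) e ees))/eqP.
by move/(implyP (allP (Y_boundary esE) e ees))/eqP.
Qed.

Lemma edge_rel_closed x y :
  (x <= p) && (y <= p) || (p < x) && (p < y) -> E x y = edge_rel es x y.
Proof.
have [k1 kp pn] := sizes => xy; rewrite /edge_rel !inE !xpair_eqE.
by case: (_ \in es); case: (_ \in es); rewrite ?orbT ?orbF //; lia.
Qed.

Lemma closed_edges_X_cut x y : x < k <= y -> E x y ->
  (x, y) = (0, p) \/ (x, y) = (k.-1, n.-1).
Proof.
have [k1 kp pn] := sizes => /andP[xk ky].
rewrite E_lt ?(leq_trans xk) // !inE !xpair_eqE.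
case/or4P=> [/andP[/eqP-> /eqP->]|xyE|xyE|xyE]; [by right|lia|lia|left].
by case/extendable_edge: xyE => _ X_edge _; apply: X_edge; rewrite /= xk.
Qed.

Lemma closed_edges_Y_cut x y : k <= x < p -> p <= y -> E x y ->
  (x, y) = (k, p) \/ (x, y) = (p.-1, n.-2).
Proof.
have [k1 kp pn] := sizes => /andP[kx xp] py.
rewrite E_lt ?(leq_trans xp) // !inE !xpair_eqE.
case/or4P=> [xyE|xyE|/andP[/eqP-> /eqP->]|xyE]; [lia|lia|by right|left].
by case/extendable_edge: xyE => _ _ Y_edge; apply: Y_edge; rewrite /= kx xp.
Qed.

Lemma num_ham_paths_YZ :
  num_ham_paths E (Y ++ Z) k n.-1 =
  num_ham_paths E Y k p.-1 * num_ham_paths E Z n.-2 n.-1.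
Proof.
have [k1 kp pn] := sizes.
apply: num_ham_paths_cut; rewrite ?mem_iota; try lia.
- exact: edge_rel_sym.
- exact: uniq_YZ.
- by rewrite E_lt ?inE ?eqxx ?orbT //; lia.
move=> x y; rewrite !mem_iota => xY yZ Exy; left.
by have [|||] := closed_edges_Y_cut _ _ Exy; [lia|lia|case; lia|].
Qed.

(* Such a path would enter and leave [Y], but between [Y] and [Z] there is only
   the edge from [p.-1] to [n.-2]. *)
Lemma num_ham_paths_YZ0 z :
  p < z < n -> num_ham_paths E (Y ++ Z) z n.-1 = 0.
Proof.
have [k1 kp pn] := sizes => zZ.
have pZY : perm_eq (Y ++ Z) (Z ++ Y) by rewrite perm_catC.
rewrite (perm_num_ham_paths _ _ _ pZY).
apply: (@num_ham_paths_bridge0 _ _ _ _ _ _ _ _ n.-2 p.-1 k);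
  rewrite ?mem_iota; try lia.
- exact: edge_rel_sym.
- by rewrite -(perm_uniq pZY).
move=> x y; rewrite !mem_iota edge_rel_sym => xZ yY Eyx.
by have [|||[-> ->]] := closed_edges_Y_cut _ _ Eyx; [lia|lia|case; lia|].
Qed.

Lemma num_ham_paths_pYZ :
  num_ham_paths E (p :: Y ++ Z) p n.-1 = num_ham_paths E (Y ++ Z) k n.-1.
Proof.
have [k1 kp pn] := sizes.
rewrite num_ham_paths_cons ?size_cat ?size_iota //; last lia.
have kYZ : k \in Y ++ Z by rewrite mem_cat mem_iota; lia.
have Epk : E p k.
  rewrite edge_rel_sym E_lt // !inE.
  by case/andP: (center_edges esE) => _ ->; rewrite !orbT.
rewrite big_mkcond (bigD1_seq k) //= Epk -[RHS]addn0; congr addn.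
rewrite big1_seq // => z /andP[zk zYZ]; case: ifP => // Epz.
move: zYZ; rewrite mem_cat !mem_iota => /orP[zY|zZ].
  rewrite edge_rel_sym in Epz.
  by have [||[]|[]] := @closed_edges_Y_cut z p _ _ Epz; lia.
by rewrite num_ham_paths_YZ0; lia.
Qed.

Lemma num_ham_paths_XpYZ :
  num_ham_paths E (iota 0 n) k.-1 n.-1 =
  num_ham_paths E X k.-1 0 * num_ham_paths E (p :: Y ++ Z) p n.-1.
Proof.
have [k1 kp pn] := sizes.
have pV : perm_eq (iota 0 n) (X ++ p :: Y ++ Z).
  have -> : iota 0 n = X ++ Y ++ p :: Z.
    rewrite [in LHS](_ : n = k + (p - k + (n - p.+1).+1)); last lia.
    by rewrite !iotaD add0n subnKC // ltnW.
  by rewrite perm_cat2l -[p :: Z]cat1s -[p :: Y ++ Z]cat1s perm_catCA.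
rewrite (perm_num_ham_paths _ _ _ pV); have uV : uniq (X ++ p :: Y ++ Z).
  by rewrite -(perm_uniq pV) iota_uniq.
have mem_pYZ x : x \in p :: Y ++ Z -> k <= x < n.
  by rewrite inE mem_cat !mem_iota; lia.
apply: num_ham_paths_cut; rewrite ?inE ?mem_cat ?mem_iota ?eqxx //; try lia.
- exact: edge_rel_sym.
- rewrite E_lt ?inE; last lia.
  by case/andP: (center_edges esE) => -> _; rewrite !orbT.
move=> x y; rewrite mem_iota => xX /mem_pYZ yYZ Exy.
by apply: closed_edges_X_cut Exy; lia.
Qed.

Theorem card_closed_cycles :
  #|hamiltonian_cycles (edge_graph n (closed_edges n es))| =
  num_block_paths n es.
Proof.
have [k1 kp pn] := sizes.
rewrite (@card_ord_graph_cycles n _ _ _ [pred x | x < k] k.-1 n.-1 0 p) /=;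
  try lia.
- rewrite num_ham_paths_XpYZ num_ham_paths_pYZ num_ham_paths_YZ.
  by congr (_ * (_ * _)); apply: eq_in_num_ham_paths => x y;
    rewrite !mem_iota => xI yI; apply: edge_rel_closed; lia.
- by rewrite E_lt ?inE ?eqxx //; lia.
move=> x y xn yn xk; rewrite -leqNgt => ky.
by apply: closed_edges_X_cut; rewrite xk.
Qed.

Lemma closed_graph_regular :
  regular_graph 4 (edge_graph n (closed_edges n es)).
Proof.
exact: edge_graph_regular (closed_edge_list esE) (degree_closed esE).
Qed.

Lemma closed_graph_connected :
  0 < num_block_paths n es ->
  connected_graph (edge_graph n (closed_edges n es)).
Proof. by rewrite -card_closed_cycles; exact: hamiltonian_connected. Qed.

Lemma degree_add_vertex x :
  degree (closed_edges n.+1 (add_vertex n es)) x =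
  degree (closed_edges n es) x + 4 * (n == x).
Proof.
have [k1 kp pn] := sizes.
have incident a b :
    a < b -> ((a == x) || (b == x)) = (a == x) + (b == x) :> nat.
  by case: (eqVneq a x) => [<-|_ _] //= ab; rewrite gtn_eqF.
by rewrite /degree /= !incident; lia.
Qed.

Lemma edge_list_add_vertex :
  edge_list n.+1 (closed_edges n.+1 (add_vertex n es)).
Proof.
have [k1 kp pn] := sizes.
have new_notin a : (a, n) \in es = false.
  by apply/negP => /extendable_edge[/= + _ _]; lia.
have anchor_notin : (p.-1, n.-1) \in es = false.
  apply/negP => /extendable_edge[_ _ /= Y_edge].
  by have /= := congr1 snd (Y_edge _); lia.
have /andP[ues ltes] := extendable_edge_list esE.
rewrite /edge_list /= ues !inE !new_notin anchor_notin !xpair_eqE.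
apply/andP; split; first lia.
do 5 (apply/andP; split; first lia).
by apply: sub_all ltes => e; lia.
Qed.

Lemma extendable_add_vertex : extendable n.+1 (add_vertex n es).
Proof.
have [k1 kp pn] := sizes; split.
- by rewrite k1 kp; lia.
- rewrite !inE !xpair_eqE.
  by case/andP: (center_edges esE) => -> ->; rewrite !orbT.
- by rewrite /= (X_boundary esE) andbT !xpair_eqE; lia.
- by rewrite /= (Y_boundary esE) andbT !xpair_eqE; lia.
- exact: edge_list_add_vertex.
apply/allP => x; rewrite mem_iota => /andP[_].
rewrite add0n ltnS leq_eqVlt degree_add_vertex => /orP[/eqP->|xn].
  by rewrite (degree_ge (closed_edge_list esE)) // eqxx.
have -> : 4 * (n == x) = 0 by rewrite gtn_eqF.
by rewrite addn0 (allP (degree_closed esE)) // mem_iota.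
Qed.

Lemma num_ham_paths_add_vertex V x y :
  {in V, forall z, z < n} ->
  num_ham_paths (edge_rel (add_vertex n es)) V x y =
  num_ham_paths (edge_rel es) V x y.
Proof.
move=> Vn; apply: eq_in_num_ham_paths => z w /Vn zn /Vn wn.
by rewrite /edge_rel !inE !xpair_eqE !(ltn_eqF zn) !(ltn_eqF wn) !andbF.
Qed.

Lemma num_block_paths_add_vertex :
  num_block_paths n.+1 (add_vertex n es) = num_block_paths n es.
Proof.
have [k1 kp pn] := sizes; rewrite /num_block_paths.
rewrite (num_ham_paths_add_vertex (V := X))
  ?(num_ham_paths_add_vertex (V := Y)); try by move=> z; rewrite mem_iota; lia.
congr (_ * (_ * _)).
have -> : iota p.+1 (n.+1 - p.+1) = Z ++ [:: n].
  by rewrite (_ : n.+1 - p.+1 = n - p.+1 + 1) ?iotaD ?subnKC //=; lia.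
have esE' := extendable_edge_list extendable_add_vertex.
rewrite (@num_ham_paths_cut _ _ _ _ _ _ _ _ n.-2 n) ?mem_iota ?inE; try lia.
- rewrite num_ham_paths1 muln1 num_ham_paths_add_vertex.
    by apply: num_ham_paths_rev; exact: edge_rel_sym.
  by move=> z; rewrite mem_iota; lia.
- exact: edge_rel_sym.
- by rewrite cat_uniq iota_uniq /= mem_iota; lia.
- by rewrite /edge_rel mem_head; lia.
move=> x y; rewrite mem_iota inE => xZ /eqP->.
rewrite (edge_rel_lt esE'); last lia.
rewrite !inE => /or3P[/eqP|/eqP|/extendable_edge[/= + _ _]]; last lia.
  by left.
by right.
Qed.
End Extendable.

Lemma add_vertex_ind (P : nat -> seq (nat * nat) -> Prop) n0 es0 :
  P n0 es0 -> (forall n es, P n es -> P n.+1 (add_vertex n es)) ->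
  forall n, n0 <= n -> exists es, P n es.
Proof.
move=> P0 PS n /subnKC <-; elim: (n - n0) => [|m [es Pes]].
  by exists es0; rewrite addn0.
by exists (add_vertex (n0 + m) es); rewrite addnS; exact: PS.
Qed.

Theorem extendable_extension n0 es0 n : extendable n0 es0 -> n0 <= n ->
  exists es,
    extendable n es /\ num_block_paths n es = num_block_paths n0 es0.
Proof.
move=> es0E; pose P m es :=
  extendable m es /\ num_block_paths m es = num_block_paths n0 es0.
apply: (add_vertex_ind (P := P) (es0 := es0)) => // m es [esE numE].
split; first exact: extendable_add_vertex.
by rewrite num_block_paths_add_vertex.
Qed.
End Construction.

(** * Straight-line drawings *)

Import Order.TTheory GRing.Theory Num.Theory.
Import numFieldNormedType.Exports.
Local Open Scope ring_scope.

Section Segments.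
Variable R : realType.
Implicit Types (a b c d q : R * R).

Definition seg_point a b (t : R) : R * R :=
  ((1 - t) * a.1 + t * b.1, (1 - t) * a.2 + t * b.2).

Definition seg a b q := exists2 t : R, 0 <= t <= 1 & q = seg_point a b t.

Lemma seg_point0 a b : seg_point a b 0 = a.
Proof.
by rewrite /seg_point subr0 !mul1r !mul0r !addr0 -surjective_pairing.
Qed.

Lemma seg_point1 a b : seg_point a b 1 = b.
Proof.
by rewrite /seg_point subrr !mul1r !mul0r !add0r -surjective_pairing.
Qed.

Lemma seg_left a b : seg a b a.
Proof. by exists 0; rewrite ?lexx ?ler01 ?seg_point0. Qed.

Lemma seg_sym a b q : seg a b q -> seg b a q.
Proof.
case=> t /andP[t0 t1] ->; exists (1 - t); first by apply/andP; split; lra.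
by rewrite /seg_point; congr pair; ring.
Qed.

Lemma seg_point_inj a b : a != b -> injective (seg_point a b).
Proof.
move=> ab s t [e1 e2]; apply/eqP; rewrite -subr_eq0; apply: contraNT ab => st.
have coord_eq (x y : R) : (1 - s) * x + s * y = (1 - t) * x + t * y -> x = y.
  move=> e; apply/eqP; rewrite -subr_eq0 -(mulrI_eq0 _ (mulfI st)).
  by apply/eqP; lra.
rewrite [a]surjective_pairing [b]surjective_pairing.
by rewrite (coord_eq _ _ e1) (coord_eq _ _ e2).
Qed.

Lemma seg_is_arc a b : a != b -> is_arc a b (seg a b).
Proof.
move=> ab; exists (seg_point a b); split.
- apply: continuous_subspaceT => t.
  have comb (c d : R) :
      ((1 - x) * c + x * d @[x --> t] --> (1 - t) * c + t * d)%classic.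
    apply: cvgD; apply: cvgM; try exact: cvg_cst; last exact: cvg_id.
    by apply: cvgB; [exact: cvg_cst | exact: cvg_id].
  exact: cvg_pair (comb a.1 b.1) (comb a.2 b.2).
- by move=> s t _ _; exact: seg_point_inj.
- exact: seg_point0.
- exact: seg_point1.
apply/seteqP; split => q /=.
  by case=> t t01 ->; exists t => //; rewrite in_itv.
by case=> t; rewrite in_itv /= => t01 <-; exists t.
Qed.

Definition affine (u v w : R) (z : R * R) := u * z.1 + v * z.2 + w.

Lemma affine_seg_point u v w a b t :
  affine u v w (seg_point a b t) =
  (1 - t) * affine u v w a + t * affine u v w b.
Proof. by rewrite /affine /seg_point /=; ring. Qed.

Lemma seg_affine_le0 u v w a b q :
  affine u v w a <= 0 -> affine u v w b <= 0 -> seg a b q ->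
  affine u v w q <= 0.
Proof. by move=> fa fb [t /andP[t0 t1] ->]; rewrite affine_seg_point; nra. Qed.

Lemma seg_affine_eq0 u v w a b q :
  seg a b q -> affine u v w a = 0 -> affine u v w b = 0 -> affine u v w q = 0.
Proof.
by move=> [t _ ->] fa fb; rewrite affine_seg_point fa fb !mulr0 addr0.
Qed.

Lemma seg_affine_end u v w a b q :
  affine u v w q <= 0 -> 0 <= affine u v w a -> 0 < affine u v w b ->
  seg a b q -> q = a.
Proof.
move=> + fa fb [t /andP[t0 t1] qE]; rewrite qE affine_seg_point => fq.
by have -> : t = 0; [nra | rewrite seg_point0].
Qed.

Lemma seg_separate u v w a b c d q :
  affine u v w a <= 0 -> affine u v w b <= 0 ->
  0 <= affine u v w c -> 0 < affine u v w d ->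
  seg a b q -> seg c d q -> q = c.
Proof.
move=> fa fb fc fd /(seg_affine_le0 fa fb) fq.
exact: seg_affine_end fq fc fd.
Qed.

Lemma seg_extreme u v w a b c :
  0 <= affine u v w a -> 0 <= affine u v w b -> affine u v w c = 0 ->
  (affine u v w a = 0 -> a = c) -> seg a b c -> a = c \/ b = c.
Proof.
move=> fa fb fc ac /seg_sym sc.
have [/ac|fa0] := eqVneq (affine u v w a) 0; first by left.
by right; apply/esym; apply: (seg_affine_end (u := u) (v := v) (w := w)) sc;
  rewrite ?fc // lt_neqAle eq_sym fa0.
Qed.
End Segments.

Section StraightDrawings.
Variable R : realType.
Implicit Types (T : eqType).

Definition meet_at_ends T (pos : T -> R * R) (e f : T * T) :=
  forall q, seg (pos e.1) (pos e.2) q -> seg (pos f.1) (pos f.2) q ->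
    exists2 v, (v \in [:: e.1; e.2]) && (v \in [:: f.1; f.2]) & q = pos v.

Definition straight_drawing T (pos : T -> R * R) (es : seq (T * T)) :=
  {in es &, forall e f, e != f -> meet_at_ends pos e f}.

Lemma meet_at_ends_sym T (pos : T -> R * R) e f :
  meet_at_ends pos e f -> meet_at_ends pos f e.
Proof.
by move=> ef q qf qe; have [v vE ->] := ef q qe qf; exists v; rewrite // andbC.
Qed.

Lemma meet_at_ends_swap T (pos : T -> R * R) x y f :
  meet_at_ends pos (x, y) f -> meet_at_ends pos (y, x) f.
Proof.
move=> ef q /seg_sym qe qf; have [v vE ->] := ef q qe qf; exists v => //.
by rewrite !inE [(v == y) || _]orbC in vE *.
Qed.

Lemma straight_drawing_cons T (pos : T -> R * R) e es :
  straight_drawing pos es -> {in es, forall f, meet_at_ends pos e f} ->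
  straight_drawing pos (e :: es).
Proof.
move=> des de f g; rewrite !inE => /predU1P[->|fes] /predU1P[->|ges] fg.
- by rewrite eqxx in fg.
- exact: de.
- exact/meet_at_ends_sym/de.
- exact: des.
Qed.

Lemma straight_drawing_cat T (pos : T -> R * R) es es' :
  straight_drawing pos es -> straight_drawing pos es' ->
  {in es & es', forall e f, meet_at_ends pos e f} ->
  straight_drawing pos (es ++ es').
Proof.
move=> des des' dx e f; rewrite !mem_cat => /orP[ees|ees] /orP[fes|fes] ef.
- exact: des.
- exact: dx.
- exact/meet_at_ends_sym/dx.
- exact: des'.
Qed.

Lemma straight_drawing_map (T T' : eqType) (h : T -> T') (D : pred T)
    (pos : T -> R * R) (pos' : T' -> R * R) es :
  {in es, forall e, D e.1 && D e.2} ->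
  {in D &, injective h} -> {in D, pos =1 pos' \o h} ->
  straight_drawing pos' [seq (h e.1, h e.2) | e <- es] ->
  straight_drawing pos es.
Proof.
move=> esD h_inj posE d e f ees fes ef q.
have /andP[De1 De2] := esD e ees; have /andP[Df1 Df2] := esD f fes.
rewrite !posE //= => qe qf.
have h_neq : (h e.1, h e.2) != (h f.1, h f.2).
  apply: contraNneq ef => -[/(h_inj _ _ De1 Df1) eq1 /(h_inj _ _ De2 Df2) eq2].
  by rewrite [e]surjective_pairing [f]surjective_pairing eq1 eq2.
have [v /andP[ve vf] ->] := d _ _ (map_f _ ees) (map_f _ fes) h_neq q qe qf.
have [x xe vx] : exists2 x, x \in [:: e.1; e.2] & v = h x.
  by move: ve; rewrite !inE => /orP[]/eqP->; [exists e.1 | exists e.2];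
    rewrite ?inE ?eqxx ?orbT.
have Dx : D x by move: xe; rewrite !inE => /orP[]/eqP->.
exists x; last by rewrite posE //= vx.
rewrite xe /=; move: vf; rewrite vx !inE.
by case/orP=> /eqP/h_inj-> //; rewrite eqxx ?orbT.
Qed.

Lemma straight_line_planar (G : graph) (pos : G -> R * R) :
  injective pos -> (forall x : G, exists y, adj x y) ->
  (forall x y z w : G, adj x y -> adj z w -> [set x; y]%SET != [set z; w]%SET ->
     meet_at_ends pos (x, y) (z, w)) ->
  planar R G.
Proof.
move=> pos_inj deg meet.
pose curve (E : {set G}) : set (R * R) :=
  fun q => exists x y, E = [set x; y]%SET /\ seg (pos x) (pos y) q.
have curveE x y : curve [set x; y]%SET = seg (pos x) (pos y).
  apply/seteqP; split => q; last by move=> qxy; exists x, y.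
  by case=> z [w [/set2_eq[[-> ->]|[-> ->]]]] // /seg_sym.
have edgeP (E : {set G}) :
    E \in edges G -> exists x y, adj x y /\ E = [set x; y]%SET.
  by rewrite inE => /existsP[x /existsP[y /andP[xy /eqP->]]]; exists x, y.
have cross (E F : {set G}) q : E \in edges G -> F \in edges G -> E != F ->
    curve E q -> curve F q -> exists2 z, z \in (E :&: F)%SET & q = pos z.
  move=> /edgeP[x [y [xy ->]]] /edgeP[z [w [zw ->]]] EF.
  rewrite !curveE => qE qF.
  have [v /andP[ve vf] ->] := meet x y z w xy zw EF q qE qF.
  by exists v => //; rewrite !inE in ve vf *; rewrite ve vf.
exists pos, curve; split => //.
  move=> x y xy; rewrite curveE; apply: seg_is_arc.
  by apply: contraTneq xy => /pos_inj ->; rewrite adj_irrefl.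
move=> E z EE Ez; apply: contraT => zE; have [y zy] := deg z.
have [||||v] := cross E [set z; y]%SET (pos z) EE.
- rewrite inE; apply/existsP; exists z; apply/existsP; exists y.
  by rewrite zy eqxx.
- by apply: contraNneq zE => ->; rewrite !inE eqxx.
- exact: Ez.
- by rewrite curveE; exact: seg_left.
by rewrite inE => /andP[vE _] /pos_inj zv; rewrite zv vE in zE.
Qed.

Lemma edge_graph_planar n es (pos : nat -> R * R) :
  {in [pred x | x < n]%N &, injective pos} ->
  (forall x : edge_graph n es, exists y, adj x y) ->
  straight_drawing pos es -> planar R (edge_graph n es).
Proof.
pose pos_val (x : edge_graph n es) := pos (val x).
move=> pos_inj deg d; apply: (@straight_line_planar _ pos_val) => //.
  by move=> x y /pos_inj xy; apply/val_inj/xy; rewrite inE ltn_ord.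
have meet a b c e : edge_rel es a b -> edge_rel es c e ->
    (a, b) != (c, e) -> (a, b) != (e, c) -> meet_at_ends pos (a, b) (c, e).
  have swap_neq (i j i' j' : nat) : (i, j) != (i', j') -> (j, i) != (j', i').
    by rewrite !xpair_eqE andbC.
  move=> /andP[_ /orP[abE|baE]] /andP[_ /orP[ceE|ecE]] neq neq_swap.
  - exact: d.
  - exact/meet_at_ends_sym/meet_at_ends_swap/meet_at_ends_sym/d.
  - by apply/meet_at_ends_swap/d; rewrite // swap_neq.
  - apply/meet_at_ends_swap/meet_at_ends_sym/meet_at_ends_swap.
    by apply/meet_at_ends_sym/d; rewrite // swap_neq.
move=> x y z w xy zw xyzw q qxy qzw.
have neq_edge (z' w' : edge_graph n es) : [set x; y]%SET != [set z'; w']%SET ->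
    (val x, val y) != (val z', val w').
  by apply: contraNneq => -[/val_inj -> /val_inj ->].
have [||v /andP[vxy vzw] ->] := meet _ _ _ _ xy zw _ _ q qxy qzw.
- exact: neq_edge.
- by apply: neq_edge; rewrite [X in _ != X]finset.setUC.
have [a axy va] : exists2 a : edge_graph n es, a \in [:: x; y] & v = val a.
  by move: vxy; rewrite !inE => /orP[]/eqP->; [exists x | exists y];
    rewrite ?inE ?eqxx ?orbT.
by exists a; rewrite ?va // axy; move: vzw; rewrite va !inE !val_eqE.
Qed.
End StraightDrawings.

Section IntegerDrawings.
Local Open Scope int_scope.

Definition cross (a b c : int * int) : int :=
  (b.1 - a.1) * (c.2 - a.2) - (b.2 - a.2) * (c.1 - a.1).

(* The line through [e] meets the segment [f] at most in [f.1]. *)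
Definition separated (T : eqType) (pos : T -> int * int) (e f : T * T) :=
  let side z := cross (pos e.1) (pos e.2) (pos z) in
  ((0 <= side f.1) && (0 < side f.2) || (side f.1 <= 0) && (side f.2 < 0)) &&
  ((side f.1 == 0) ==> (f.1 \in [:: e.1; e.2])).

Definition drawing_check (T : eqType) (pos : T -> int * int)
    (es : seq (T * T)) :=
  let swap (e : T * T) := (e.2, e.1) in
  all2rel (fun e f => [|| e == f, separated pos e f, separated pos e (swap f),
                          separated pos f e | separated pos f (swap e)]) es.
End IntegerDrawings.

Section IntegerDrawingsP.
Variable R : realType.

Definition real_point (a : int * int) : R * R := (a.1%:~R, a.2%:~R).

Lemma real_point_inj : injective real_point.
Proof. by move=> [a1 a2] [b1 b2] [/intr_inj-> /intr_inj->]. Qed.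

Lemma separated_meet (T : eqType) (pos : T -> int * int) e f :
  separated pos e f -> meet_at_ends (real_point \o pos) e f.
Proof.
case/andP=> sep side0 q /= qe qf.
set a := pos e.1 in qe sep side0; set b := pos e.2 in qe sep side0.
pose u (s : R) := s * (a.2 - b.2)%:~R; pose v (s : R) := s * (b.1 - a.1)%:~R.
pose w (s : R) := s * (a.1 * b.2 - a.2 * b.1)%:~R.
have crossE (s : R) c :
    affine (u s) (v s) (w s) (real_point c) = s * (cross a b c)%:~R.
  by rewrite /affine /u /v /w /cross !(rmorphB, rmorphM) /=; ring.
have crossa : cross a b a = 0 by rewrite /cross; ring.
have crossb : cross a b b = 0 by rewrite /cross; ring.
have meet_end (s : R) : 0 <= s * (cross a b (pos f.1))%:~R ->
    0 < s * (cross a b (pos f.2))%:~R -> q = real_point (pos f.1).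
  by move=> f1 f2; apply: (seg_separate (u := u s) (v := v s) (w := w s)) qe qf;
    rewrite crossE ?crossa ?crossb ?mulr0.
have qE : q = real_point (pos f.1).
  case/orP: sep => /andP[f1 f2].
    by apply: (meet_end 1); rewrite mul1r ?ler0z ?ltr0z.
  by apply: (meet_end (-1)); rewrite mulN1r ?oppr_ge0 ?oppr_gt0 ?lerz0 ?ltrz0.
exists f.1 => //; rewrite mem_head andbT; apply: (implyP side0).
move/(seg_affine_eq0 (u := u 1) (v := v 1) (w := w 1)): qe.
rewrite qE !crossE crossa crossb mulr0 mul1r => /(_ erefl erefl)/eqP.
by rewrite intr_eq0.
Qed.

Lemma drawing_checkP (T : eqType) (pos : T -> int * int) es :
  drawing_check pos es -> straight_drawing (real_point \o pos) es.
Proof.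
move=> /allrelP check e f ees fes /negbTE ef.
have := check e f ees fes; rewrite ef /=.
case: e f {ees fes ef check} => [x y] [z w] /or4P[] /separated_meet //.
- by move/meet_at_ends_sym/meet_at_ends_swap/meet_at_ends_sym.
- exact: meet_at_ends_sym.
- by move/meet_at_ends_sym/meet_at_ends_swap.
Qed.
End IntegerDrawingsP.

(** * Drawings in a triangle *)

Section Triangle.
Variable R : realType.
Implicit Types (a b c q z : R * R).

(* The size 8 allows an initial drawing with integer coordinates. *)
Definition in_triangle z := [/\ 0 <= z.1, 0 <= z.2 & z.1 + z.2 <= 8].

Definition corners : seq (R * R) := [:: (0, 0); (8, 0); (0, 8)].

Lemma seg_in_triangle a b q :
  in_triangle a -> in_triangle b -> seg a b q -> in_triangle q.
Proof.
move=> [a1 a2 a12] [b1 b2 b12] ab.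
have := seg_affine_le0 (u := -1) (v := 0) (w := 0) _ _ ab.
have := seg_affine_le0 (u := 0) (v := -1) (w := 0) _ _ ab.
have := seg_affine_le0 (u := 1) (v := 1) (w := -8) _ _ ab.
rewrite /affine => q12 q2 q1.
by split; [have := q1 | have := q2 | have := q12]; lra.
Qed.

Lemma seg_corner a b c :
  in_triangle a -> in_triangle b -> c \in corners -> seg a b c ->
  a = c \/ b = c.
Proof.
case: a b => [a1 a2] [b1 b2] [/= ? ? ?] [/= ? ? ?].
rewrite !inE => /or3P[]/eqP->.
- by apply: (seg_extreme (u := 1) (v := 1) (w := 0)); rewrite /affine /=;
    try move=> ?; try congr pair; lra.
- by apply: (seg_extreme (u := -1) (v := 0) (w := 8)); rewrite /affine /=;
    try move=> ?; try congr pair; lra.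
- by apply: (seg_extreme (u := 0) (v := -1) (w := 8)); rewrite /affine /=;
    try move=> ?; try congr pair; lra.
Qed.

(* Maps the triangle (0,0), (8,0), (0,8) onto (0,0), (0,8), (8/3,8/3), which
   makes room for the next vertex at (8,0). *)
Definition squeeze z : R * R := (z.2 / 3, z.1 + z.2 / 3).

Lemma squeeze_inj : injective squeeze.
Proof. by move=> [a1 a2] [b1 b2] [e1 e2]; congr pair; lra. Qed.

Lemma squeeze_in_triangle z : in_triangle z -> in_triangle (squeeze z).
Proof. by case=> ? ? ?; split; rewrite /squeeze /=; lra. Qed.

Lemma seg_squeeze a b q :
  seg (squeeze a) (squeeze b) q -> exists2 r, seg a b r & q = squeeze r.
Proof.
case=> t t01 ->; exists (seg_point a b t); first by exists t.
by rewrite /squeeze /seg_point /=; congr pair; lra.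
Qed.

Lemma squeeze_seg_corner c z :
  c \in [:: (8, 0); (0, 8)] -> in_triangle z ->
  seg (squeeze c) (8, 0) (squeeze z) -> z = c.
Proof.
rewrite !inE => + [z1 z2 z12] => /orP[]/eqP-> sz.
  have := seg_affine_eq0 (u := -1) (v := -1) (w := 8) sz.
  rewrite /affine /squeeze /= => z0.
  by rewrite [z]surjective_pairing; congr pair; have := z0; lra.
by apply: squeeze_inj; apply: (seg_affine_end (u := 2) (v := 1) (w := -8)) sz;
  rewrite /affine /squeeze /=; lra.
Qed.
End Triangle.

Section TriangleDrawing.
Variables (R : realType) (p : nat).

Definition right_edges (es : seq (nat * nat)) := [seq e <- es | (p < e.1)%N].

Record triangle_drawing n es (pos : nat -> R * R) : Prop := TriangleDrawing {
  triangle_pos : forall x, (p < x < n)%N -> in_triangle (pos x);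
  triangle_origin : pos p.+1 = (0, 0);
  triangle_last : pos n.-1 = (8, 0);
  triangle_penult : pos n.-2 = (0, 8);
  triangle_inj : {in [pred x | p < x < n]%N &, injective pos};
  triangle_edges : straight_drawing pos (right_edges es) }.

Definition next_pos n (pos : nat -> R * R) x :=
  if x == n then (8, 0) else squeeze (pos x).

Variables (n : nat) (es : seq (nat * nat)) (pos : nat -> R * R).
Hypothesis esn : edge_list n es.

Lemma right_edges_range e :
  e \in right_edges es -> (p < e.1 < n)%N && (p < e.2 < n)%N.
Proof.
by case: e => x y; rewrite mem_filter => /andP[/= px /(edge_listP esn)/=]; lia.
Qed.

Hypotheses (pn : (p.+3 < n)%N) (td : triangle_drawing n es pos).

Lemma next_pos_old x : (x < n)%N -> next_pos n pos x = squeeze (pos x).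
Proof. by move=> xn; rewrite /next_pos ltn_eqF. Qed.

Lemma next_pos_new : next_pos n pos n = (8, 0).
Proof. by rewrite /next_pos eqxx. Qed.

Lemma next_pos_inj :
  {in [pred x | p < x < n.+1]%N &, injective (next_pos n pos)}.
Proof.
have old_neq_new x : (p < x < n)%N -> squeeze (pos x) != (8, 0).
  by case/(triangle_pos td) => z1 z2 z12; apply/eqP => -[/= e1 e2]; lra.
move=> x y; rewrite !inE !ltnS /next_pos => /andP[px xn] /andP[py yn].
have [->|xn'] := eqVneq x n; have [->|yn'] := eqVneq y n => //.
- by move=> /esym/eqP; rewrite (negbTE (old_neq_new y _)) //; lia.
- by move=> /eqP; rewrite (negbTE (old_neq_new x _)) //; lia.
by move=> /squeeze_inj/(triangle_inj td); apply; rewrite inE; lia.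
Qed.

Lemma old_edges_meet : straight_drawing (next_pos n pos) (right_edges es).
Proof.
move=> [x y] [z w] /= xyE zwE xyzw q /=.
have /= /andP[xn yn] := right_edges_range xyE.
have /= /andP[zn wn] := right_edges_range zwE.
rewrite !next_pos_old; try lia.
move=> /seg_squeeze[r rxy ->] /seg_squeeze[s szw /squeeze_inj rs].
rewrite -{}rs in szw.
have [v vE ->] := triangle_edges td xyE zwE xyzw rxy szw; exists v => //.
rewrite next_pos_old //.
by case/andP: vE; rewrite !inE /= => /orP[]/eqP-> _; lia.
Qed.

Lemma new_edge_meet x f :
  (p < x < n)%N -> pos x \in [:: (8, 0); (0, 8)] -> f \in right_edges es ->
  meet_at_ends (next_pos n pos) (x, n) f.
Proof.
move=> xn xc; case: f => y z /right_edges_range/= /andP[yn zn] q /=.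
rewrite next_pos_new !next_pos_old; try lia.
move=> qx /seg_squeeze[r ryz qr]; rewrite {}qr in qx *.
have [ty tz] := (triangle_pos td yn, triangle_pos td zn).
have rx := squeeze_seg_corner xc (seg_in_triangle ty tz ryz) qx.
exists x; last by rewrite next_pos_old ?rx //; lia.
have cx : pos x \in corners R by rewrite inE xc orbT.
rewrite rx in ryz; rewrite mem_head !inE.
by have [/(triangle_inj td yn xn)->|/(triangle_inj td zn xn)->] :=
  seg_corner ty tz cx ryz; rewrite eqxx ?orbT.
Qed.

Lemma new_edges_meet : meet_at_ends (next_pos n pos) (n.-2, n) (n.-1, n).
Proof.
move=> q /=; rewrite next_pos_new !next_pos_old; try lia.
rewrite (triangle_last td) (triangle_penult td) => /seg_sym qv qu.
exists n; rewrite ?inE ?eqxx ?orbT // next_pos_new.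
by apply: (seg_separate (u := -1) (v := -1) (w := 8)) qu qv;
  rewrite /affine /squeeze /=; lra.
Qed.

Lemma right_edges_add_vertex :
  right_edges (add_vertex n es) = [:: (n.-2, n), (n.-1, n) & right_edges es].
Proof. by rewrite /right_edges /= !ifT //; lia. Qed.

Lemma triangle_drawing_next :
  triangle_drawing n.+1 (add_vertex n es) (next_pos n pos).
Proof.
split.
- move=> x /andP[px]; rewrite ltnS leq_eqVlt => /orP[/eqP->|xn].
    by rewrite next_pos_new; split=> /=; lra.
  rewrite next_pos_old //; apply/squeeze_in_triangle/(triangle_pos td).
  by rewrite px.
- rewrite next_pos_old ?(triangle_origin td) /squeeze /=; last lia.
  by congr pair; lra.
- exact: next_pos_new.
- rewrite /= next_pos_old ?(triangle_last td) /squeeze /=; last lia.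
  by congr pair; lra.
- exact: next_pos_inj.
rewrite right_edges_add_vertex; apply: straight_drawing_cons.
  apply: straight_drawing_cons => [|f fes]; first exact: old_edges_meet.
  apply: new_edge_meet => //; first lia.
  by rewrite (triangle_last td) mem_head.
move=> f; rewrite inE => /predU1P[->|fes]; first exact: new_edges_meet.
apply: new_edge_meet => //; first lia.
by rewrite (triangle_penult td) !inE eqxx orbT.
Qed.
End TriangleDrawing.

(** * Extending a planar graph *)

Section FramedDrawing.
Variables (R : realType) (k p n0 : nat) (es0 : seq (nat * nat)).
Variable coords : nat -> int * int.

Definition left_edges (es : seq (nat * nat)) := [seq e <- es | (e.1 <= p)%N].

Record framed_drawing : Prop := FramedDrawing {
  frame_extendable : extendable k p n0 es0;
  frame_edges : drawing_check coords (closed_edges k p n0 es0);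
  frame_uniq : uniq (map coords (iota 0 n0));
  frame_left : all (fun x => 8 < (coords x).1 + (coords x).2) (iota 0 p.+1);
  frame_right : all (fun x => [&& 0 <= (coords x).1, 0 <= (coords x).2
    & (coords x).1 + (coords x).2 <= 8]) (iota p.+1 (n0 - p.+1));
  frame_center : (coords p).2 < 0;
  frame_corners : [/\ coords p.+1 = (0, 0), coords n0.-1 = (8, 0)
                    & coords n0.-2 = (0, 8)];
  frame_left_edges :
    all (fun e => (e.2 <= p)%N || (e == (p, p.+1))) (left_edges es0) }.

Hypothesis frame : framed_drawing.

Lemma coords_inj : {in [pred x | x < n0]%N &, injective coords}.
Proof.
move=> x y; rewrite !inE => xn yn xy; apply/eqP.
rewrite -(nth_uniq (0, 0) _ _ (frame_uniq frame)) ?size_map ?size_iota //.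
by rewrite !(nth_map 0%N) ?size_iota // !nth_iota // xy.
Qed.

Lemma frame_triangle_drawing :
  triangle_drawing p n0 es0 (@real_point R \o coords).
Proof.
have [p0 p1 p2] := frame_corners frame.
split=> /=; rewrite ?p0 ?p1 ?p2 //.
- move=> x xn; have /allP/(_ x) := frame_right frame; rewrite mem_iota.
  move=> /(_ _)/and3P[|x1 x2 x12]; first lia.
  by split; rewrite /= ?ler0z // -intrD (ler_int _ _ 8).
- move=> x y; rewrite !inE => /andP[_ xn] /andP[_ yn] /real_point_inj.
  exact: coords_inj.
move=> e f; rewrite !mem_filter => /andP[_ ees] /andP[_ fes].
by apply: (drawing_checkP (frame_edges frame)); rewrite !inE ?ees ?fes !orbT.
Qed.

(* The vertex of the given drawing that has the position of [x], for [x] on the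
   boundary of the triangle or outside of it. *)
Definition frame_label n x : nat :=
  if (x <= p.+1)%N then x else if x == n.-1 then n0.-1 else n0.-2.

Definition on_frame n : pred nat :=
  [pred x | [|| x <= p.+1, x == n.-1 | x == n.-2]%N].

Section Extension.
Variables (n : nat) (es : seq (nat * nat)) (pos : nat -> R * R).
Hypotheses (esE : extendable k p n es) (leftE : left_edges es = left_edges es0).
Hypothesis td : triangle_drawing p n es pos.

Let sizes : [/\ (1 < k)%N, (k < p)%N, (p.+3 < n)%N & (p.+3 < n0)%N].
Proof.
have /and3P[-> -> ->] := extendable_sizes esE.
by have /and3P[_ _ ->] := extendable_sizes (frame_extendable frame).
Qed.

Definition framed_pos x : R * R :=
  if (x <= p)%N then real_point R (coords x) else pos x.

Lemma framed_pos_right x : (p < x)%N -> framed_pos x = pos x.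
Proof. by move=> px; rewrite /framed_pos leqNgt px. Qed.

Lemma framed_pos_frame x :
  on_frame n x -> framed_pos x = real_point R (coords (frame_label n x)).
Proof.
have [k1 kp pn pn0] := sizes; have [p0 p1 p2] := frame_corners frame.
have [xp xf|px] := leqP x p; first by rewrite /framed_pos /frame_label xp leqW.
rewrite framed_pos_right // => /or3P[xp|/eqP->|/eqP->].
- have -> : x = p.+1 by lia.
  by rewrite /frame_label leqnn p0 (triangle_origin td).
- by rewrite /frame_label ifF ?eqxx ?p1 ?(triangle_last td) //; lia.
- by rewrite /frame_label ifF ?ifF ?p2 ?(triangle_penult td) //; lia.
Qed.

Lemma frame_label_inj : {in on_frame n &, injective (frame_label n)}.
Proof.
have [k1 kp pn pn0] := sizes => x y; rewrite !inE /frame_label => xf yf.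
by do !case: ifP; lia.
Qed.

Lemma framed_pos_left x : (x <= p)%N -> 8 < (framed_pos x).1 + (framed_pos x).2.
Proof.
move=> xp; rewrite /framed_pos xp /= -intrD (ltr_int _ 8).
by apply: (allP (frame_left frame)); rewrite mem_iota.
Qed.

Lemma framed_pos_inj : {in [pred x | x < n]%N &, injective framed_pos}.
Proof.
have [k1 kp pn pn0] := sizes.
have left_right x y :
    (x <= p)%N -> (p < y < n)%N -> framed_pos x <> framed_pos y.
  move=> xp yn xy; have := framed_pos_left xp.
  rewrite {}xy framed_pos_right; last lia.
  by case: (triangle_pos td yn) => *; lra.
move=> x y; rewrite !inE => xn yn.
have [xp|px] := leqP x p; have [yp|py] := leqP y p.
- rewrite /framed_pos xp yp => /real_point_inj/coords_inj.
  by apply; rewrite inE; lia.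
- by move/left_right => /(_ xp); rewrite py yn => /(_ isT).
- by move/esym/left_right => /(_ yp); rewrite px xn => /(_ isT).
- rewrite !framed_pos_right // => /(triangle_inj td).
  by apply; rewrite inE; lia.
Qed.

Lemma left_edges_closed m fs : left_edges fs = left_edges es0 ->
  left_edges (closed_edges k p m fs) =
  [:: (k.-1, m.-1), (p, m.-1), (p.-1, m.-2) & left_edges es0].
Proof.
have [k1 kp _ _] := sizes => fs0.
by rewrite -fs0 /left_edges /= !ifT //; lia.
Qed.

Lemma left_edges_framed e :
  e \in left_edges (closed_edges k p n es) ->
  (e.1 <= p)%N && [|| e.2 <= p, e == (p, p.+1), e.2 == n.-1 | e.2 == n.-2]%N.
Proof.
move=> eE; apply/andP; split; first by move: eE; rewrite mem_filter => /andP[].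
move: eE; rewrite left_edges_closed // !inE.
case/or4P=> [/eqP->|/eqP->|/eqP->|]; rewrite ?eqxx ?orbT //.
by move/(allP (frame_left_edges frame))/orP=> -[->|->]; rewrite ?orbT.
Qed.

Lemma frame_label_left_edges :
  [seq (frame_label n e.1, frame_label n e.2)
    | e <- left_edges (closed_edges k p n es)] =
  left_edges (closed_edges k p n0 es0).
Proof.
have [k1 kp pn pn0] := sizes.
have label_le x : (x <= p.+1)%N -> frame_label n x = x.
  by rewrite /frame_label => ->.
have label_last : frame_label n n.-1 = n0.-1.
  by rewrite /frame_label ifF ?eqxx //; lia.
have label_penult : frame_label n n.-2 = n0.-2.
  by rewrite /frame_label !ifF //; lia.
rewrite !left_edges_closed //= label_last label_penult !label_le; try lia.
congr [:: _, _, _ & _]; rewrite -[RHS]map_id; apply/eq_in_map => -[x y] xyE.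
have := allP (frame_left_edges frame) _ xyE; move: xyE; rewrite mem_filter /=.
by move=> /andP[/= xp _] /orP[yp|/eqP[_ ->]]; rewrite !label_le //; lia.
Qed.

Lemma left_edges_drawing :
  straight_drawing framed_pos (left_edges (closed_edges k p n es)).
Proof.
apply: (straight_drawing_map (h := frame_label n) (D := on_frame n)
  (pos' := @real_point R \o coords)).
- move=> [x y] /left_edges_framed/andP[/= xp yE].
  rewrite /on_frame /= (leqW xp) /=.
  by case/or4P: yE => [/leqW->|/eqP[_ ->]|->|->]; rewrite ?leqnn ?orbT.
- exact: frame_label_inj.
- exact: framed_pos_frame.
rewrite frame_label_left_edges => e f.
rewrite !mem_filter => /andP[_ ees] /andP[_ fes].
exact: (drawing_checkP (frame_edges frame)).
Qed.

Lemma left_edge_triangle e z :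
  e \in left_edges (closed_edges k p n es) -> in_triangle z ->
  seg (framed_pos e.1) (framed_pos e.2) z ->
  [/\ (p < e.2)%N, z = framed_pos e.2 & z \in corners R].
Proof.
case: e => [x y] /left_edges_framed/andP[/= xp yE] [z1 z2 z12] sz.
have x8 := framed_pos_left xp.
have z8 : affine 1 1 (-8) z <= 0 by rewrite /affine; lra.
have [yp|py] := leqP y p.
  have y8 := framed_pos_left yp.
  have zx : z = framed_pos x.
    by apply: seg_affine_end z8 _ _ sz; rewrite /affine; lra.
  by move: x8; rewrite -zx; lra.
suff : z = framed_pos y /\ framed_pos y \in corners R by case=> -> yc; split.
move/seg_sym: sz => sz.
case/orP: yE => [yp|/orP[/eqP[xE yE]|yE]]; first lia.
  have yO : framed_pos y = (0, 0).
    by rewrite yE framed_pos_right ?(triangle_origin td).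
  rewrite yO mem_head; split=> //; rewrite -yO.
  apply: (seg_affine_end (u := 0) (v := -1) (w := 0)) sz; rewrite /affine;
    [lra|by rewrite yO /=; lra|].
  rewrite xE /framed_pos leqnn /= mul0r add0r addr0 mulN1r oppr_gt0.
  by rewrite ltrz0 (frame_center frame).
have [yc y8] : framed_pos y \in corners R /\
    (framed_pos y).1 + (framed_pos y).2 = 8.
  rewrite framed_pos_right //; case/orP: yE => /eqP->.
    by rewrite (triangle_last td) !inE eqxx orbT /=; split=> //; lra.
  by rewrite (triangle_penult td) !inE eqxx !orbT /=; split=> //; lra.
by split=> //; apply: seg_affine_end z8 _ _ sz; rewrite /affine; lra.
Qed.

Lemma left_right_meet e f :
  e \in left_edges (closed_edges k p n es) -> f \in right_edges p es ->
  meet_at_ends framed_pos e f.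
Proof.
case: e f => [x y] [z w] xyE zwE q /= qxy qzw.
have /= xy_lt := edge_listP (closed_edge_list esE)
  (mem_subseq (filter_subseq _ _) xyE).
have /= /andP[zn wn] := right_edges_range (extendable_edge_list esE) zwE.
rewrite !framed_pos_right in qzw; [|lia|lia].
have [tz tw] := (triangle_pos td zn, triangle_pos td wn).
have [/= py qy qc] := left_edge_triangle xyE (seg_in_triangle tz tw qzw) qxy.
have yn : (p < y < n)%N by lia.
exists y; rewrite // !inE eqxx orbT /=.
rewrite framed_pos_right // in qy.
by have [] := seg_corner tz tw qc qzw; rewrite qy => /(triangle_inj td _ yn)->;
  rewrite ?eqxx ?orbT.
Qed.

Lemma framed_straight_drawing :
  straight_drawing framed_pos (closed_edges k p n es).
Proof.
have [k1 kp pn pn0] := sizes.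
have rightE : right_edges p (closed_edges k p n es) = right_edges p es.
  by rewrite /right_edges /= !ifF //; lia.
have right_drawing : straight_drawing framed_pos (right_edges p es).
  apply: (straight_drawing_map (h := id) (D := [pred x | p < x]%N)
    (pos' := pos)) => //.
  - move=> e /(right_edges_range (extendable_edge_list esE)).
    by move=> /andP[/andP[pe1 _] /andP[pe2 _]]; apply/andP.
  - by move=> x; exact: framed_pos_right.
  rewrite (eq_map (g := id)) ?map_id; first exact: triangle_edges td.
  by case.
have cat_drawing :=
  straight_drawing_cat left_edges_drawing right_drawing left_right_meet.
move=> e f ees fes; apply: cat_drawing;
  by rewrite mem_cat -rightE !mem_filter ?ees ?fes !andbT; case: leqP.
Qed.

Lemma framed_graph_planar : planar R (edge_graph n (closed_edges k p n es)).
Proof.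
apply: edge_graph_planar framed_pos_inj _ framed_straight_drawing => x.
have /eqP := closed_graph_regular esE x; rewrite eqn_leq => /andP[_].
by move=> /(leq_trans (isT : (0 < 4)%N))/card_gt0P[y]; rewrite inE; exists y.
Qed.
End Extension.

Lemma left_edges_add_vertex n es :
  (p.+3 < n)%N -> left_edges (add_vertex n es) = left_edges es.
Proof. by move=> pn; rewrite /left_edges /= !ifF //; lia. Qed.

Theorem planar_extension n : (n0 <= n)%N -> exists es,
  [/\ extendable k p n es, num_block_paths k p n es = num_block_paths k p n0 es0
    & planar R (edge_graph n (closed_edges k p n es))].
Proof.
move=> n0n; pose P m es := [/\ extendable k p m es,
  num_block_paths k p m es = num_block_paths k p n0 es0,
  left_edges es = left_edges es0
  & exists pos : nat -> R * R, triangle_drawing p m es pos].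
have [||es [esE numE leftE [pos td]]] :=
  add_vertex_ind (P := P) (es0 := es0) _ _ n0n.
- split=> //; first exact: frame_extendable.
  by exists (@real_point R \o coords); exact: frame_triangle_drawing.
- move=> m es [esE numE leftE [pos td]].
  have /and3P[_ _ pm] := extendable_sizes esE.
  split; first exact: extendable_add_vertex.
  + by rewrite num_block_paths_add_vertex.
  + by rewrite left_edges_add_vertex.
  exists (next_pos m pos).
  exact: triangle_drawing_next (extendable_edge_list esE) pm td.
by exists es; split=> //; exact: framed_graph_planar leftE td.
Qed.
End FramedDrawing.

(** * The two families *)

Definition shift_edges m (es : seq (nat * nat)) :=
  [seq (m + e.1, m + e.2)%N | e <- es].

Definition two_block_edges k (block right : seq (nat * nat)) :=
  block ++ shift_edges k block ++
  [:: (0, 2 * k); (k, 2 * k); (2 * k, (2 * k).+1)]%N ++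
  shift_edges (2 * k).+1 right.

(* K5 minus the edge {0, 4}. *)
Definition K5_block : seq (nat * nat) :=
  [:: (0, 1); (0, 2); (0, 3); (1, 2); (1, 3); (1, 4); (2, 3); (2, 4); (3, 4)]%N.

Definition K5_edges := two_block_edges 5 K5_block
  [:: (0, 1); (0, 4); (0, 5); (1, 3); (1, 4); (1, 5); (2, 3); (2, 4); (2, 6);
      (2, 7); (3, 5); (3, 6); (4, 5); (6, 7)]%N.

(* The octahedron minus the edge {0, 5}. *)
Definition octahedron_block : seq (nat * nat) :=
  [:: (0, 2); (0, 3); (0, 4); (1, 2); (1, 3); (1, 4); (1, 5); (2, 4); (2, 5);
      (3, 4); (3, 5)]%N.

Definition octahedral_edges := two_block_edges 6 octahedron_block
  [:: (0, 1); (0, 2); (0, 4); (1, 2); (1, 3); (1, 5); (2, 3); (2, 4); (3, 4);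
      (3, 5); (4, 6); (5, 6); (5, 7); (6, 7); (6, 8); (7, 8)]%N.

Definition octahedral_coords : nat -> int * int := nth (0, 0)
  [:: (18, 5); (13, 6); (15, 8); (14, 3); (15, 5); (11, 6); (19, 13); (8, 14);
      (11, 17); (13, 10); (15, 12); (4, 14); (17, -7); (0, 0); (0, 2); (1, 2);
      (2, 3); (1, 1); (1, 5); (4, 2); (0, 8); (8, 0)].

Lemma K5_extendable : extendable 5 10 19 K5_edges.
Proof. by split; vm_compute. Qed.

Lemma num_K5_block_paths : num_block_paths 5 10 19 K5_edges = (6 * (6 * 4))%N.
Proof. by rewrite /num_block_paths !num_ham_pathsE //; vm_compute. Qed.

Lemma octahedral_framed_drawing :
  framed_drawing 6 12 22 octahedral_edges octahedral_coords.
Proof. by split; [split| | | | | | |]; vm_compute. Qed.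

Lemma num_octahedral_block_paths :
  num_block_paths 6 12 22 octahedral_edges = (8 * (8 * 5))%N.
Proof. by rewrite /num_block_paths !num_ham_pathsE //; vm_compute. Qed.

Theorem theorem1 (R : realType) :
  (forall n : nat, (19 <= n)%N ->
     exists G : graph,
       [/\ #|G| = n, connected_graph G, regular_graph 4 G
         & #|hamiltonian_cycles G| = 144%N]) /\
  (forall n' : nat, (22 <= n')%N ->
     exists G : graph,
       [/\ #|G| = n', connected_graph G, planar R G, regular_graph 4 G
         & #|hamiltonian_cycles G| = 320%N]).
Proof.
split=> n nn.
  have [es [esE]] := extendable_extension K5_extendable nn.
  rewrite num_K5_block_paths => numE.
  exists (edge_graph n (closed_edges 5 10 n es)); split; first exact: card_ord.
  - by apply: closed_graph_connected; rewrite ?numE.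
  - exact: closed_graph_regular.
  - by rewrite card_closed_cycles.
have [es [esE + es_planar]] := planar_extension R octahedral_framed_drawing nn.
rewrite num_octahedral_block_paths => numE.
exists (edge_graph n (closed_edges 6 12 n es)); split=> //.
- exact: card_ord.
- by apply: closed_graph_connected; rewrite ?numE.
- exact: closed_graph_regular.
- by rewrite card_closed_cycles.
Qed.
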